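(* Two partitions $\pi=\{N_1,\dots,N_r\}$ and $\pi'=\{N'_1,\dots,N'_r\}$, $\sum_{j=1}^r N_j=\sum_{j=1}^r N'_j=N$, are equivalent if and only if the associated functions $\psi_\pi,\psi_{\pi'}:\{1,2,\dots,N\}\to\{0,1,\dots,r\}$ are equal. Consequently their (common) orbit under $\mathfrak{S}(r)$ is of length $$\big|\mathfrak{S}(r)/\mathfrak{S}_\pi\big|=\frac{r!}{\psi_\pi(1)!\,\psi_\pi(2)!\cdots\psi_\pi(N)!}.$$
   Context: $\Pi_r(N)$ is the set of partitions of $N$ of length $r$, i.e. sequences $\pi=\{N_1,\dots,N_r\}$ of positive integers with $\sum N_j=N$. The permutation group $\mathfrak{S}(r)$ on $r$ symbols acts on $\Pi_r(N)$ by permuting indices; two partitions are equivalent if they lie in one orbit (i.e. $N_j=N'_{\sigma(j)}$ for some permutation $\sigma$). $\mathfrak{S}_\pi\subset\mathfrak{S}(r)$ is the isotropy group of $\pi$. The function $\psi_\pi$ is $\psi_\pi(n)=|\{1\le j\le r: N_j=n\}|$. Convention: $0!=1$. *)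

(* Defs.v *)
From HB Require Import structures.
From mathcomp Require Import all_boot all_order all_algebra all_fingroup.

Set Implicit Arguments.
Unset Strict Implicit.
Unset Printing Implicit Defensive.

Local Open Scope nat_scope.

(* Pi_r(N): ordered sequences of r positive integers with sum N. *)
Record partition_of (r N : nat) := PartitionOf {
  part :> {ffun 'I_r -> nat};
  part_axiom : [forall j, 0 < part j] && (\sum_j part j == N)
}.

Section PartitionType.
Variables r N : nat.

HB.instance Definition _ := [isSub for @part r N].
HB.instance Definition _ := [Choice of partition_of r N by <:].

Lemma part_gt0 (p : partition_of r N) j : 0 < p j.
Proof. by have /andP[/forallP] := part_axiom p. Qed.

Lemma part_sum (p : partition_of r N) : \sum_j p j = N.
Proof. by have /andP[_ /eqP] := part_axiom p. Qed.

Lemma part_le (p : partition_of r N) j : p j <= N.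
Proof. by rewrite -{2}(part_sum p) (bigD1 j) //= leq_addr. Qed.

(* The parts are at most N, so partition_of r N embeds in the finite type
   {ffun 'I_r -> 'I_N.+1}. *)
Definition part_code (p : partition_of r N) : {ffun 'I_r -> 'I_N.+1} :=
  [ffun j => inord (p j)].

Definition part_decode (f : {ffun 'I_r -> 'I_N.+1}) :
    option (partition_of r N) :=
  insub [ffun j => f j : nat].

Lemma part_codeK : pcancel part_code part_decode.
Proof.
move=> p; rewrite /part_decode.
suff -> : [ffun j => part_code p j : nat] = part p by rewrite valK.
by apply/ffunP=> j; rewrite !ffunE inordK // ltnS part_le.
Qed.

HB.instance Definition _ : isCountable (partition_of r N) :=
  PCanIsCountable part_codeK.
HB.instance Definition _ : isFinite (partition_of r N) :=
  PCanIsFinite part_codeK.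

Lemma part_perm_axiom (p : partition_of r N) (s : 'S_r) :
  let q := [ffun j => p ((s^-1)%g j)] in
  [forall j, 0 < q j] && (\sum_j q j == N).
Proof.
apply/andP; split; first by apply/forallP=> j; rewrite ffunE part_gt0.
rewrite -[X in _ == X](part_sum p) (reindex_inj (@perm_inj _ s)) /=.
by apply/eqP/eq_bigr=> j _; rewrite ffunE permK.
Qed.

(* Actions in the library are right actions and permutations compose from left
   to right, hence the inverse: the part of index j moves to index s j. *)
Definition part_perm (p : partition_of r N) (s : 'S_r) : partition_of r N :=
  PartitionOf (part_perm_axiom p s).

Lemma part_perm_is_action : is_action [set: 'S_r] part_perm.
Proof.
apply: is_total_action => [p | p s t]; apply/val_inj/ffunP=> j; rewrite !ffunE.
  by rewrite invg1 perm1.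
by rewrite invMg permM.
Qed.

Canonical part_action := Action part_perm_is_action.

Definition part_orbit (p : partition_of r N) : {set partition_of r N} :=
  orbit part_action [set: 'S_r] p.

Definition part_equiv (p q : partition_of r N) : Prop := q \in part_orbit p.

Lemma part_equivP (p q : partition_of r N) :
  part_equiv p q <-> exists s : 'S_r, forall j, p j = q (s j).
Proof.
split=> [/orbitP[s _ <-] | [s pq]].
  by exists s => j; rewrite ffunE permK.
apply/orbitP; exists s; rewrite ?inE //.
by apply/val_inj/ffunP=> j; rewrite ffunE pq permKV.
Qed.

Definition isotropy (p : partition_of r N) : {group 'S_r} :=
  'C[p | part_action]%G.

Definition psi (p : partition_of r N) (n : nat) : nat :=
  #|[set j : 'I_r | p j == n]|.

Lemma psi_le (p : partition_of r N) n : psi p n <= r.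
Proof. by rewrite -[X in _ <= X]card_ord max_card. Qed.

End PartitionType.

(* Main.v *)
(* A permutation fixes pi exactly when it preserves every fibre of pi, so the
   isotropy group is the product of the symmetric groups of the fibres, of
   order prod_n psi(n)!, and orbit-stabiliser gives the length of the orbit. *)
Require Import Defs.
From HB Require Import structures.
From mathcomp Require Import all_boot all_order all_algebra all_fingroup.

Set Implicit Arguments.
Unset Strict Implicit.
Unset Printing Implicit Defensive.

Import Order.TTheory GRing.Theory Num.Theory.
Local Open Scope ring_scope.

Section FiberPermutations.
Variables (T : finType) (f : T -> nat).

(* The threshold m lets the fibres be treated one at a time: from m to m + 1
   one gains exactly the permutations of the fibre over m. *)
Definition fiber_perms (m : nat) : {set {perm T}} :=
  [set s : {perm T} |
    [forall x, (f (s x) == f x) && ((m <= f x)%N ==> (s x == x))]].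

Lemma fiber_permsP m (s : {perm T}) :
  reflect ((forall x, f (s x) = f x) /\ (forall x, (m <= f x)%N -> s x = x))
          (s \in fiber_perms m).
Proof.
rewrite inE; apply: (iffP forallP) => [fs | [fs fix_s] x].
  by split=> x; have /andP[/eqP sx /implyP fx] := fs x => // /fx/eqP.
by rewrite fs eqxx; apply/implyP=> /fix_s ->.
Qed.

Lemma fiber_perms_group_set m : group_set (fiber_perms m).
Proof.
apply/group_setP; split=> [|s t /fiber_permsP[fs fix_s] /fiber_permsP[ft fix_t]].
  by apply/fiber_permsP; split=> x *; rewrite perm1.
apply/fiber_permsP; split=> x => [|le_mx]; rewrite permM; first by rewrite ft.
by rewrite fix_s // fix_t.
Qed.
Canonical fiber_perms_group m := Group (fiber_perms_group_set m).

Let fiber n := [set x | f x == n].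

(** Write [s] as [(s * b^-1) * b] with [b] the restriction of [s] to the fibre over [m]: the left
    factor fixes that fibre pointwise and agrees with [s] elsewhere. *)
Lemma fiber_permsS m : fiber_perms m.+1 = (fiber_perms m * Sym (fiber m))%g.
Proof.
apply/setP=> s; apply/idP/mulsgP=> [/fiber_permsP[fs fix_s] | [a b]].
  (* [restr_perm] agrees with [s] on the fibre only because [s] stabilises it; otherwise it would be
     the identity. *)
  have nSs : s \in 'N(fiber m | 'P)%g.
    by apply/astabsP=> x; rewrite !inE /= apermE fs.
  set b := restr_perm (fiber m) s.
  have b_on : perm_on (fiber m) b := restr_perm_on _ _.
  have aE x : (s * b^-1)%g x = if f x == m then x else s x.
    rewrite permM; case: ifP => fxm.
      by rewrite -(restr_permE nSs) ?inE // permK.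
    by rewrite (out_perm (perm_onV b_on)) // inE fs fxm.
  exists (s * b^-1)%g b; rewrite ?mulgKV //; last by rewrite inE.
  apply/fiber_permsP; split=> x; rewrite aE; case: ifP => // nfx le_mx.
  by rewrite fix_s // ltn_neqAle eq_sym nfx.
move=> /fiber_permsP[fa fix_a]; rewrite inE => b_on -> {s}.
apply/fiber_permsP; split=> x => [|lt_mx]; rewrite permM.
  rewrite -[in RHS]fa.
  have [ax_m | /(out_perm b_on)-> //] := boolP (a x \in fiber m).
  have : b (a x) \in fiber m by rewrite (perm_closed _ b_on).
  by move: ax_m; rewrite !inE => /eqP-> /eqP.
by rewrite fix_a ?(ltnW lt_mx) // (out_perm b_on) // inE neq_ltn lt_mx orbT.
Qed.

(** By induction on [m]: the product in [fiber_permsS] is direct as a product of sets, since a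
    permutation in both factors fixes the fibre over [m] pointwise and also everything outside
    it. *)
Lemma card_fiber_perms m :
  #|fiber_perms m| = (\prod_(0 <= n < m) #|[set x | f x == n]|`!)%N.
Proof.
elim: m => [|m IHm].
  rewrite big_geq //; suff -> : fiber_perms 0 = 1%g by rewrite cards1.
  apply/setP=> s; rewrite [RHS]inE; apply/fiber_permsP/eqP=> [[_ s1] | ->].
    by apply/permP=> x; rewrite s1 ?perm1.
  by split=> x; rewrite perm1.
rewrite big_nat_recr //= -IHm -card_Sym fiber_permsS TI_cardMg //.
apply/trivgP/subsetP=> s /setIP[/fiber_permsP[_ fix_s]].
rewrite inE => s_on; rewrite inE; apply/eqP/permP=> x; rewrite perm1.
have [x_m | /(out_perm s_on) //] := boolP (x \in fiber m).
by rewrite fix_s //; move: x_m; rewrite inE => /eqP->.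
Qed.

End FiberPermutations.

Section PartitionOrbits.
Variables r N : nat.
Implicit Types p q : partition_of r N.

Lemma psi0 p : psi p 0 = 0%N.
Proof. by apply: eq_card0 => j; rewrite inE eqn0Ngt Defs.part_gt0. Qed.

Lemma psi_gt p n : (N < n)%N -> psi p n = 0%N.
Proof.
move=> ltNn; apply: eq_card0 => j; rewrite inE ltn_eqF //.
exact: leq_ltn_trans (part_le p j) ltNn.
Qed.

Lemma count_psi p n : count_mem n [seq p j | j <- enum 'I_r] = psi p n.
Proof.
rewrite count_map enumT /psi cardE size_filter.
by apply: eq_count => j; rewrite [RHS]inE.
Qed.

(** [psi] gives the multiplicities in the tuple of parts, and two tuples with equal multiplicities
    differ by a permutation of indices. *)
Lemma part_equiv_psi p q :
  part_equiv p q <->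
  (forall n : nat, (1 <= n <= N)%N -> psi p n = psi q n).
Proof.
split=> [/part_equivP[s pq] n _ | eq_psi].
  (* [s] maps the fibre of [p] over [n] onto that of [q]. *)
  rewrite /psi -(card_imset _ (@perm_inj _ s)); apply: eq_card => j.
  by rewrite -[j](permKV s) mem_imset ?inE ?pq //; apply: perm_inj.
apply/part_equivP; have /tuple_permP[s Es] : perm_eq [tuple p j | j < r] [tuple q j | j < r].
  apply/allP=> n _ /=; rewrite !count_psi; apply/eqP.
  (* Outside [1..N] both multiplicities vanish. *)
  case: n => [|n]; first by rewrite !psi0.
  by case: (leqP n.+1 N) => [le_nN | lt_Nn]; [apply: eq_psi | rewrite !psi_gt].
exists s => j; have /val_inj/(congr1 (fun t => tnth t j)) := Es.
by rewrite !tnth_mktuple.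
Qed.

Lemma card_isotropy p :
  #|isotropy p| = (\prod_(1 <= n < N.+1) (psi p n)`!)%N.
Proof.
(* Every part is at most [N], so at threshold [N.+1] no index is forced to be fixed. *)
have -> : isotropy p = fiber_perms p N.+1 :> {set _}.
  apply/setP=> s; apply/astab1P/fiber_permsP=> [ps | [ps _]].
    split=> x; last by rewrite ltnNge part_le.
    by rewrite -[in LHS]ps ffunE permK.
  by apply/val_inj/ffunP=> j; rewrite ffunE -ps permKV.
(* The extra factor at [n = 0] is [0! = 1]. *)
by rewrite card_fiber_perms big_nat_recl // big_add1 /= -/(psi p 0) psi0 mul1n.
Qed.

End PartitionOrbits.

Theorem theorem3p8 (r N : nat) (p p' : partition_of r N) :
  [/\ part_equiv p p' <-> (forall n : nat, (1 <= n <= N)%N -> psi p n = psi p' n),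
      part_equiv p p' -> part_orbit p = part_orbit p',
      #|part_orbit p| = #|[set: 'S_r] : isotropy p|%g
    & #|[set: 'S_r] : isotropy p|%g%:R =
        (r`!)%:R / \prod_(1 <= n < N.+1) ((psi p n)`!)%:R :> rat].
Proof.
split; first exact: part_equiv_psi.
- by move/orbit_eqP.
- by rewrite /part_orbit card_orbit setTI.
rewrite -natr_prod -card_isotropy -(card_Sn r) -cardsT.
rewrite -(Lagrange (subsetT (isotropy p))) natrM mulrAC mulfV ?mul1r //.
by rewrite pnatr_eq0 -lt0n cardG_gt0.
Qed.
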